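(* Let $X$ be a continuous vector field in a neighborhood $U\subset\mathbb{R}^N$ of the origin, and for some $r>0$ let there be a limit $$\widehat X(x)=\lim_{\varepsilon\to0}(\delta_\varepsilon^{-1})_*\,\varepsilon^{r}X(\delta_\varepsilon x)$$ uniform in a neighborhood of the origin. Let $\Phi:U\to\mathbb{R}^N$ be a $C^1$-diffeomorphism (onto its image) on a neighborhood of the origin such that $\Phi(0)=0$, there is a limit $$\lambda(x):=\lim_{\varepsilon\to0}D\delta_\varepsilon^{-1}\circ D\Phi\circ D\delta_\varepsilon(x)$$ uniform in a neighborhood of the origin, and $\det\lambda(0)\ne0$. Denote $Y(y)=\Phi_*X(\Phi^{-1}(y))$. Then there is a limit $$\widehat Y(y)=\lim_{\varepsilon\to0}(\delta_\varepsilon^{-1})_*\,\varepsilon^{r}Y(\delta_\varepsilon y)$$ uniform in a neighborhood of the origin, and $\widehat Y(y)=L_*\widehat X(L^{-1}(y))$, where the map $L$ is defined (near the origin) by the uniform limit $L(x)=\lim_{\varepsilon\to0}\delta_\varepsilon^{-1}\circ\Phi\circ\delta_\varepsilon(x)$.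
   Context: Fix a tuple $(\sigma_1,\dots,\sigma_N)$ of positive real numbers. For $\varepsilon>0$ set $\delta_\varepsilon(x_1,\dots,x_N)=(\varepsilon^{\sigma_1}x_1,\dots,\varepsilon^{\sigma_N}x_N)$. The expression $D\delta_\varepsilon^{-1}\circ D\Phi\circ D\delta_\varepsilon(x)$ is the differential at $x$ of $\delta_\varepsilon^{-1}\circ\Phi\circ\delta_\varepsilon$, i.e. the $N\times N$ matrix with entries $\varepsilon^{\sigma_l-\sigma_k}\frac{\partial\Phi_k}{\partial x_l}(\delta_\varepsilon x)$. The subscript $*$ denotes push-forward of tangent vectors by the differential: $\Phi_*X(\Phi^{-1}(y))=D\Phi(\Phi^{-1}(y))\,X(\Phi^{-1}(y))$, $L_*\widehat X(L^{-1}(y))=DL(L^{-1}(y))\,\widehat X(L^{-1}(y))$, and $(\delta_\varepsilon^{-1})_*\varepsilon^rX(\delta_\varepsilon x)$ is the vector at $x$ with $k$-th component $\varepsilon^{r-\sigma_k}X_k(\delta_\varepsilon x)$, where $X_k$ is the $k$-th component of $X$. *)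

(* Defs.v *)
From HB Require Import structures.
From mathcomp Require Export all_boot all_order all_algebra.
From mathcomp Require Export all_classical all_reals all_analysis.
Set Implicit Arguments.
Unset Strict Implicit.
Unset Printing Implicit Defensive.
Import Order.TTheory GRing.Theory Num.Theory.
Import numFieldNormedType.Exports.
Local Open Scope classical_set_scope.
Local Open Scope ring_scope.

(* Points and vectors of R^N are row vectors. Maps and vector fields given only
   on a neighborhood are total functions whose values elsewhere are never
   constrained. *)

Definition dil (R : realType) (N : nat) (sigma : 'I_N -> R) (e : R)
    (x : 'rV[R]_N) : 'rV[R]_N :=
  \row_k (e `^ sigma k * x 0 k).

(* The inverse of [dil sigma e] when [0 < e]. *)
Definition dil_inv (R : realType) (N : nat) (sigma : 'I_N -> R) (e : R)
    (x : 'rV[R]_N) : 'rV[R]_N :=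
  \row_k ((e `^ sigma k)^-1 * x 0 k).

Definition conj_dil (R : realType) (N : nat) (sigma : 'I_N -> R)
    (f : 'rV[R]_N -> 'rV[R]_N) (e : R) : 'rV[R]_N -> 'rV[R]_N :=
  dil_inv sigma e \o f \o dil sigma e.

(* The push-forward by [dil_inv sigma e] of the vector [e ^ r X (dil e x)]
   attached to [dil e x]; it is attached to [x]. *)
Definition rescale_field (R : realType) (N : nat) (sigma : 'I_N -> R) (r : R)
    (X : 'rV[R]_N -> 'rV[R]_N) (e : R) (x : 'rV[R]_N) : 'rV[R]_N :=
  \row_k (e `^ (r - sigma k) * X (dil sigma e x) 0 k).

(* The library's ['J f x] acts on row vectors from the right, so its transpose
   is the usual matrix, with entry (k, l) equal to the partial derivative of
   the k-th component in the l-th variable. *)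
Definition Dmx (R : realType) (N : nat) (f : 'rV[R]_N -> 'rV[R]_N)
    (x : 'rV[R]_N) : 'M[R]_N :=
  ('J f x)^T.

Definition C1_on (R : realType) (N : nat) (U : set 'rV[R]_N)
    (f : 'rV[R]_N -> 'rV[R]_N) : Prop :=
  (forall x, U x -> differentiable f x) /\ {within U, continuous (Dmx f)}.

Definition C1_diffeo (R : realType) (N : nat) (U : set 'rV[R]_N)
    (f finv : 'rV[R]_N -> 'rV[R]_N) : Prop :=
  [/\ open U, open (f @` U), (forall x, U x -> finv (f x) = x),
      C1_on U f & C1_on (f @` U) finv].

Definition pushforward (R : realType) (N : nat)
    (f finv X : 'rV[R]_N -> 'rV[R]_N) (y : 'rV[R]_N) : 'rV[R]_N :=
  'd f (finv y) (X (finv y)).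

(* [F e] tends to [G] as [e] tends to 0 (with [e > 0]), uniformly in some
   neighborhood of the origin. *)
Definition ulim0 (R : realType) (N : nat) (W : uniformType)
    (F : R -> 'rV[R]_N -> W) (G : 'rV[R]_N -> W) : Prop :=
  exists2 A : set 'rV[R]_N,
    nbhs (0 : 'rV[R]_N) A & {uniform A, F @ 0^'+ --> G}.

(* Main.v *)
(* Uniform convergence of the Jacobians of the dilated maps
   Phi_e = dil_e^-1 o Phi o dil_e, together with Phi_e 0 = 0, makes Phi_e
   uniformly Cauchy (mean value inequality); hence Phi_e -> L with L' = lambda.
   Near the origin all the Phi_e and L are uniformly Lipschitz-close to the
   invertible map lambda(0), so Newton's iteration gives inverses on a fixed
   ball, Lipschitz with a common constant, and Phi_e^-1 -> L^-1 uniformly.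
   Finally the rescaled Y at y = Phi_e x is (rescaled X at x) * Phi_e' x, and
   the factors converge locally uniformly to continuous limits; compactness of
   a closed ball turns this into uniform convergence in y. *)

From HB Require Import structures.
Require Import Defs.
From mathcomp Require Import ring lra.
Import Order.TTheory GRing.Theory Num.Theory.
Import numFieldNormedType.Exports.
Local Open Scope classical_set_scope.
Local Open Scope ring_scope.

(** Joins completeness of matrix spaces with their norm: both the Newton fixed point and the limits
    of uniformly Cauchy families need complete normed modules. *)
HB.instance Definition _ (R : realType) m n := Complete.on 'M[R]_(m, n).

(** * Norms of matrices and Jacobians *)

Section jacobians.
Context {R : realType}.
Set Implicit Arguments.
Unset Strict Implicit.

Lemma mx_coord_le_norm m n (A : 'M[R]_(m, n)) i j : `|A i j| <= `|A|.
Proof.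
rewrite [leRHS]/Num.Def.normr /= mx_normrE.
exact: (le_bigmax _ (fun ij => `|A ij.1 ij.2|) (i, j)).
Qed.

Lemma mx_norm_le m n (A : 'M[R]_(m, n)) c :
  0 <= c -> (forall i j, `|A i j| <= c) -> `|A| <= c.
Proof.
move=> c0 Ac; rewrite [leLHS]/Num.Def.normr /= mx_normrE.
by apply/bigmax_leP; split => // -[i j] _; exact: Ac.
Qed.

(** The norm is the largest absolute value of an entry, hence the factor [n]; [n%:R * |B|] plays the
    part of an operator norm of right multiplication by [B]. *)
Lemma norm_mulmx_le m n p (A : 'M[R]_(m, n)) (B : 'M[R]_(n, p)) :
  `|A *m B| <= n%:R * `|B| * `|A|.
Proof.
apply: mx_norm_le => [|i j]; first by rewrite !mulr_ge0.
rewrite mxE (le_trans (ler_norm_sum _ _ _))//.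
rewrite -mulrA mulr_natl -[X in _ *+ X]card_ord -sumr_const ler_sum// => k _.
by rewrite normrM mulrC ler_pM// mx_coord_le_norm.
Qed.

Lemma norm_trmx m n (A : 'M[R]_(m, n)) : `|A^T| = `|A|.
Proof.
have H p q (B : 'M[R]_(p, q)) : `|B^T| <= `|B|.
  by apply: mx_norm_le => // i j; rewrite mxE mx_coord_le_norm.
by apply/eqP; rewrite eq_le H -{1}[A]trmxK H.
Qed.

Lemma diff_jacobian n m (f : 'rV[R]_n -> 'rV[R]_m) x v :
  'd f x v = v *m 'J f x.
Proof. by rewrite mul_rV_lin1. Qed.

(** Gives differentiability and the value of the Jacobian together from one first-order estimate,
    which suits both inverse maps and limits. *)
Lemma jacobianP n m (f : 'rV[R]_n -> 'rV[R]_m) x M :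
  (forall eta, 0 < eta -> \forall h \near (0 : 'rV[R]_n),
     `|f (h + x) - f x - h *m M| <= eta * `|h|) <->
  differentiable f x /\ 'J f x = M.
Proof.
have mulMc : continuous (mulmxr M : 'rV[R]_n -> 'rV[R]_m).
  apply: bounded_linear_continuous; apply/linear_boundedP.
  near=> k => h; rewrite (le_trans (norm_mulmx_le _ _)) ?ler_wpM2r//.
split=> [H|[+ <-] eta eta0].
  have E : f \o shift x = cst (f x) + (mulmxr M : 'rV[R]_n -> 'rV[R]_m) +o_ (0 : 'rV[R]_n) id.
    apply/eqaddoP => eta eta0; near=> h.
    rewrite /= opprD addrA; near: h; exact: H.
  have D : 'd f x = mulmxr M :> (_ -> _) by exact: diff_unique.
  split; last by apply/row_matrixP => i; rewrite !rowE -diff_jacobian D.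
  by apply/diff_locallyP; rewrite D.
move=> /diff_locally/eqaddoP/(_ eta eta0); apply: filterS => h /=.
by rewrite -diff_jacobian opprD addrA.
Unshelve. all: by end_near. Qed.

(** The scalar mean value theorem is applied along the segment to each component of [f] minus the
    linear map [M]. The intermediate point varies with the component, which the entrywise norm
    tolerates. *)
Lemma mean_value_jacobian n m (f : 'rV[R]_n -> 'rV[R]_m) M c a s :
  (forall z, ball a s z -> differentiable f z) ->
  (forall z, ball a s z -> `|'J f z - M| <= c) ->
  forall x y, ball a s x -> ball a s y ->
  `|f x - f y - (x - y) *m M| <= n%:R * c * `|x - y|.
Proof.
move=> df Jf x y ax ay; set v := x - y.
have c0 : 0 <= c by apply: le_trans (Jf _ ax).
(* Balls are convex, so the segment from [y] to [x] stays where [f] is controlled. *)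
have seg (t : R) : t \in `[0, 1]%R -> ball a s (y + t *: v).
  rewrite in_itv/= => /andP[t0 t1].
  move: ax ay; rewrite -!ball_normE /= => ax ay.
  have -> : a - (y + t *: v) = t *: (a - x) + (1 - t) *: (a - y).
    by apply/rowP => i; rewrite !mxE; ring.
  apply: (@le_lt_trans _ _ (t * Num.max `|a - x| `|a - y| +
     (1 - t) * Num.max `|a - x| `|a - y|)).
    rewrite (le_trans (ler_normD _ _))// !normrZ ger0_norm// ger0_norm ?subr_ge0//.
    by rewrite lerD// ler_wpM2l ?subr_ge0// le_max lexx ?orbT.
  by rewrite -mulrDl addrC subrK mul1r gt_max ax ay.
apply: mx_norm_le => [|i k]; first by rewrite !mulr_ge0.
rewrite ord1 {i}.
pose g t : R := (f (y + t *: v) - t *: (v *m M)) 0 k.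
have dg (t : R) : t \in `[0, 1]%R -> is_derive t 1 g ((v *m ('J f (y + t *: v) - M)) 0 k).
  move=> /seg/df dft.
  pose G := (f \o (cst y + *:%R^~ v)) - *:%R^~ (v *m M).
  have dG : is_diff t G ('d f (y + t *: v) \o (0 + *:%R^~ v) - *:%R^~ (v *m M)).
    have dl : is_diff t (cst y + *:%R^~ v) (0 + *:%R^~ v).
      exact: (@is_diffD _ _ _ _ _ _ _ _ (is_diff_cst _ _) (is_diff_scalel _ _)).
    have df' : is_diff ((cst y + *:%R^~ v) t) f ('d f (y + t *: v)).
      exact: differentiableP.
    have dc := @is_diff_comp _ _ _ _ _ _ _ _ _ dl df'.
    exact: (@is_diffB _ _ _ _ _ _ _ _ dc (is_diff_scalel _ _)).
  have Gt : derivable G t 1 by apply: diff_derivable; exact: ex_diff.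
  have -> : (v *m ('J f (y + t *: v) - M)) 0 k = 'D_1 g t.
    have := derive_mx Gt; rewrite deriveE; last exact: ex_diff.
    rewrite diff_val => /matrixP/(_ 0 k); rewrite [RHS]mxE /= => <-.
    by rewrite mulmxBr -diff_jacobian !fctE /= add0r !scale1r.
  by apply: derivableP; exact: (derivable_mxP _ _ _).1.
pose g' t := (v *m ('J f (y + t *: v) - M)) 0 k.
have g_derive (t : R) : t \in `]0, 1[%R -> is_derive t 1 g (g' t).
  by move=> /subset_itv_oo_cc; exact: dg.
have g_cont : {within `[0, 1], continuous g}.
  by apply: derivable_within_continuous => t /dg dgt; case: dgt.
have [t t01 gE] := MVT_segment ler01 g_derive g_cont.
have -> : (f x - f y - v *m M) 0 k = (v *m ('J f (y + t *: v) - M)) 0 k.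
  rewrite -[RHS]mulr1 -[1 in RHS]subr0 -[X in X * _]/(g' t) -gE /g.
  by rewrite !scale1r !scale0r addr0 subr0 [y + v]addrC subrK !mxE; ring.
rewrite (le_trans (mx_coord_le_norm _ _ _))// (le_trans (norm_mulmx_le _ _))//.
by rewrite ler_wpM2r// ler_wpM2l//; exact/Jf/seg.
Qed.
End jacobians.

(** * Local inversion of maps close to an invertible linear map *)

Section local_inversion.
Context {R : realType}.
Set Implicit Arguments.
Unset Strict Implicit.

(** On [B], the difference of [f] and the linear map [M] is [c]-Lipschitz. *)
Definition near_linear N (f : 'rV[R]_N -> 'rV[R]_N) (M : 'M[R]_N) c B :=
  forall x y, B x -> B y -> `|f x - f y - (x - y) *m M| <= c * `|x - y|.

Lemma cvg_at_normP (V W : normedModType R) (F : V -> W) (x : V) (y : W) :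
  F z @[z --> x] --> y <->
  forall e, 0 < e -> \forall z \near x, `|y - F z| < e.
Proof. exact: cvgrPdist_lt. Qed.

Lemma cvg_at_comp (V W Z : normedModType R) (g : V -> W) (F : W -> Z) (x : V) (y : W)
    (z : Z) :
  g u @[u --> x] --> y -> F u @[u --> y] --> z ->
  forall e, 0 < e -> \forall u \near x, `|z - F (g u)| < e.
Proof. by move=> gy Fz; exact: (cvg_at_normP _ _ _).1 (cvg_comp _ _ gy Fz). Qed.

Lemma C1_onP N (U : set 'rV[R]_N) (f : 'rV[R]_N -> 'rV[R]_N) : open U ->
  C1_on U f <-> forall x, U x -> differentiable f x /\ 'J f z @[z --> x] --> 'J f x.
Proof.
move=> oU.
have trE x : (Dmx f z @[z --> x] --> Dmx f x) <-> ('J f z @[z --> x] --> 'J f x).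
  by split=> /cvg_at_normP H; apply/cvg_at_normP => e /H; apply: filterS => z;
    rewrite /Dmx -linearB/= norm_trmx.
rewrite /C1_on continuous_open_subspace//; split=> [[df cf] x Ux|H].
  by split; [exact: df|apply/trE/cf; rewrite inE].
split=> [x /H[]//|x]; by rewrite inE => /H[_ /trE].
Qed.

Lemma invmx_sub_mul n (A B : 'M[R]_n) : A \in unitmx -> B \in unitmx ->
  (invmx B - invmx A) *m B = invmx A *m (A - B).
Proof. by move=> Au Bu; rewrite mulmxBl mulmxBr !mulVmx. Qed.

Variables (N : nat) (M : 'M[R]_N) (K : R).
Hypotheses (Mu : M \in unitmx) (K0 : 0 < K).
(** Any number of rows is allowed, because the bound is used for vectors and for differences of
    inverse Jacobians. *)
Hypothesis MK : forall m (v : 'M[R]_(m, N)), `|v *m invmx M| <= K * `|v|.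

(** Absorption: with Lipschitz constant [(2 * K)^-1] the error term is half of [a] and moves to the
    left. *)
Let le_half a b : a <= b + K * ((2 * K)^-1 * a) -> a <= 2 * b.
Proof.
have -> : K * ((2 * K)^-1 * a) = a / 2.
  by field; rewrite gt_eqF.
lra.
Qed.

Let norm_le_M m (v : 'M[R]_(m, N)) : `|v| <= K * `|v *m M|.
Proof. by rewrite -[X in `|X| <= _](mulmxK Mu). Qed.

(** Yields injectivity and a Lipschitz constant [2 * K] of the inverse that depends on [M] only,
    hence is common to a whole family of maps. *)
Lemma near_linear_expand f B x y : near_linear f M (2 * K)^-1 B ->
  B x -> B y -> `|x - y| <= 2 * K * `|f x - f y|.
Proof.
move=> fM Bx By; rewrite -mulrA; apply: le_half.
rewrite (le_trans (norm_le_M _))// -mulrDr ler_wpM2l ?(ltW K0)//.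
rewrite -[X in `|X| <= _](subKr (f x - f y)) (le_trans (ler_normB _ _))// lerD2l.
exact: fM.
Qed.

(** The targets reached fill a ball whose radius depends on [s] and [K] only, not on the particular
    [f]. *)
Lemma near_linear_surj f a s y :
  near_linear f M (2 * K)^-1 (closed_ball_ Num.norm a s) ->
  0 <= s -> 2 * K * `|y - f a| <= s -> exists2 x, `|a - x| <= s & f x = y.
Proof.
move=> fM s0 yfa; pose B : set 'rV[R]_N := closed_ball_ Num.norm a s.
(* T is the Newton map with frozen derivative M, a 1/2-contraction of B. *)
pose T x : 'rV[R]_N := x + (y - f x) *m invmx M.
have TB x z : B x -> B z -> `|T x - T z| <= 2^-1 * `|x - z|.
  move=> Bx Bz.
  have -> : T x - T z = - ((f x - f z - (x - z) *m M) *m invmx M).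
    rewrite mulmxBl mulmxK// /T !mulmxBl; apply/rowP => i; rewrite !mxE; ring.
  rewrite normrN (le_trans (MK _))//.
  have -> : 2^-1 * `|x - z| = K * ((2 * K)^-1 * `|x - z|).
    by field; rewrite gt_eqF.
  by rewrite ler_wpM2l ?(ltW K0)// fM.
have Ba : B a by rewrite /B/closed_ball_/= subrr normr0.
(* Half of the radius [s] pays for the contraction, the other half for the first Newton step, of
   length at most [K * |y - f a|]. *)
have TBB : {homo T : x / B x >-> B x}.
  move=> x Bx; rewrite /B /closed_ball_ /=.
  have -> : a - T x = (T a - T x) - (y - f a) *m invmx M.
    by rewrite /T; apply/rowP => i; rewrite !mxE; ring.
  rewrite (le_trans (ler_normB _ _))//.
  rewrite (le_trans (lerD (TB _ _ Ba Bx) (MK _)))//.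
  have : `|a - x| <= s := Bx.
  move: yfa; lra.
have [|||x Bx xE] := @banach_fixed_point R _ B (mkfun_fun TBB).
- have h0 : (0 : R) <= 2^-1 by rewrite invr_ge0.
  exists (NngNum h0); split => /=; first by lra.
  by move=> [x z] [/= Bx Bz]; exact: TB.
- exact: closed_closed_ball_.
- by exists a.
exists x => //; have : x = T x := xE.
rewrite /T => /eqP; rewrite -subr_eq0 opprD addNKr oppr_eq0 => /eqP.
move=> /(congr1 (mulmx^~ M)); rewrite mulmxKV// mul0mx => /eqP.
by rewrite subr_eq0 => /eqP.
Qed.

(** * Smoothness of the local inverse *)

Section inverse.
Variables (f : 'rV[R]_N -> 'rV[R]_N) (s c : R).
(** [N%:R * c] is the Lipschitz constant that the mean value inequality draws from an entrywise
    bound [c] on the Jacobians. *)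
Hypotheses (s0 : 0 < s) (cK : N%:R * c <= (2 * K)^-1).
Hypothesis df : forall x, ball 0 s x -> differentiable f x.
Hypothesis Jf : forall x, ball 0 s x -> `|'J f x - M| <= c.
Hypothesis Jfc : forall x, ball 0 s x -> 'J f z @[z --> x] --> 'J f x.

Lemma jacobian_near_linear : near_linear f M (2 * K)^-1 (ball 0 s).
Proof.
move=> x y Bx By; rewrite (le_trans (mean_value_jacobian df Jf Bx By))//.
by rewrite ler_wpM2r.
Qed.

(** Each Jacobian is itself close to [M], so absorption applies again and bounds its inverse
    uniformly in [x]. *)
Let J_expand x m (v : 'M[R]_(m, N)) : ball 0 s x -> `|v| <= 2 * K * `|v *m 'J f x|.
Proof.
move=> Bx; rewrite -mulrA; apply: le_half.
rewrite (le_trans (norm_le_M _))// -mulrDr ler_wpM2l ?(ltW K0)//.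
rewrite -[X in `|v *m X|](subKr ('J f x)) mulmxBr (le_trans (ler_normB _ _))//.
rewrite lerD2l (le_trans (norm_mulmx_le _ _))// ler_wpM2r// (le_trans _ cK)//.
by rewrite ler_wpM2l// Jf.
Qed.

Let J_unit x : ball 0 s x -> 'J f x \in unitmx.
Proof.
move=> Bx; rewrite -row_free_unit -kermx_eq0; apply/rowV0P => v /sub_kermxP vJ.
by apply/normr0_eq0/le_anti; rewrite normr_ge0 (le_trans (J_expand v Bx))// vJ normr0 mulr0.
Qed.

Section local_inverse.
Variable g : 'rV[R]_N -> 'rV[R]_N.
Hypotheses (gf : forall x, ball 0 s x -> g (f x) = x) (ofB : open (f @` ball 0 s)).

Let K2 : 0 < 2 * K. Proof. by rewrite mulr_gt0. Qed.

Let gE y x : ball 0 s x -> (f @` ball 0 s) y -> `|g y - x| <= 2 * K * `|y - f x|.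
Proof.
by move=> Bx [z Bz <-]; rewrite gf//; exact: near_linear_expand jacobian_near_linear _ _.
Qed.

Let near_fB x : ball 0 s x -> \forall y \near f x, (f @` ball 0 s) y.
Proof. by move=> Bx; apply: open_nbhs_nbhs; split => //; exists x. Qed.

(** The first-order error of [g] for the increment [h], multiplied by ['J f x], is up to sign that
    of [f] for the increment [k] of [g]. *)
Lemma local_inverse_differentiable x : ball 0 s x ->
  differentiable g (f x) /\ 'J g (f x) = invmx ('J f x).
Proof.
move=> Bx; apply/jacobianP => eta eta0.
have [_ /(_ (conj (df Bx) erefl))] := jacobianP f x ('J f x).
(* One factor [2 * K] is lost in undoing ['J f x], the other in [|k| <= 2 * K * |h|]. *)
move=> /(_ (eta / (2 * K) / (2 * K))); rewrite !divr_gt0// => /(_ isT).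
move=> /nbhs_normP[d /= d0 dE].
have nfB : \forall h \near (0 : 'rV[R]_N), (f @` ball 0 s) (f x + h).
  by apply/(nbhs0P (f @` ball 0 s)); exact: near_fB.
have nd : \forall h \near (0 : 'rV[R]_N), `|h| < d / (2 * K).
  by apply: (@nbhs0_lt _ 'rV[R]_N); rewrite divr_gt0.
near=> h; have fBh : (f @` ball 0 s) (h + f x) by rewrite addrC; near: h.
pose k := g (h + f x) - x.
have kh : `|k| <= 2 * K * `|h| by rewrite (le_trans (gE Bx fBh))// addrK.
rewrite gf// -/k.
have fk : f (k + x) - f x = h.
  by rewrite /k subrK; case: fBh => z Bz fz; rewrite -fz gf// fz addrK.
rewrite (le_trans (J_expand _ Bx))// mulmxBl mulmxKV ?J_unit//.
have kd : `|0 - k| < d.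
  rewrite sub0r normrN (le_lt_trans kh)// mulrC -ltr_pdivlMr//.
  by near: h.
have := dE k kd; rewrite fk distrC -(ler_pM2l K2) => /le_trans; apply.
rewrite (_ : eta * `|h| = 2 * K * (eta / (2 * K) / (2 * K) * (2 * K * `|h|))).
  by rewrite !ler_wpM2l// ?divr_ge0// ltW.
by field; rewrite gt_eqF.
Unshelve. all: by end_near. Qed.

(** Multiplying the difference of inverses by ['J f z] turns it into [W] times a difference of
    Jacobians of [f], and [J_expand] undoes the multiplication. *)
Lemma local_inverse_jacobian_cvg x : ball 0 s x ->
  'J g y @[y --> f x] --> 'J g (f x).
Proof.
move=> Bx; have [dgx ->] := local_inverse_differentiable Bx.
have gc : g y @[y --> f x] --> x.
  by rewrite -[X in _ --> X](gf Bx); exact: differentiable_continuous.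
set W := invmx ('J f x); apply/cvg_at_normP => e e0.
have C0 : 0 < 2 * K * (N%:R * `|W| + 1).
  by rewrite mulr_gt0// ltr_wpDl// mulr_ge0.
have nJ := cvg_at_comp gc (Jfc Bx) (divr_gt0 e0 C0).
near=> y.
have [z Bz zy] : (f @` ball 0 s) y by near: y; exact: near_fB.
have [_ JE] := local_inverse_differentiable Bz; rewrite -zy JE.
rewrite distrC (le_lt_trans (J_expand _ Bz))//.
have -> : (invmx ('J f z) - W) *m 'J f z = W *m ('J f x - 'J f z).
  by apply: invmx_sub_mul; exact: J_unit.
have : `|'J f x - 'J f z| < e / (2 * K * (N%:R * `|W| + 1)).
  by rewrite -(gf Bz) zy; near: y.
rewrite ltr_pdivlMr// => /(le_lt_trans _); apply.
rewrite (le_trans (ler_wpM2l _ (norm_mulmx_le _ _)))// ?(ltW K2)//.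
rewrite (_ : _ * (_ * _ * _) = `|'J f x - 'J f z| * (2 * K * (N%:R * `|W|))).
  by rewrite !ler_wpM2l ?(ltW K2)// lerDl.
ring.
Unshelve. all: by end_near. Qed.
End local_inverse.

(** The image is open because Newton's iteration runs in a small closed ball around each of its
    preimages; the expansion bound gives injectivity. *)
Lemma C1_diffeo_ball : exists finv, C1_diffeo (ball 0 s) f finv.
Proof.
have oB : open (ball (0 : 'rV[R]_N) s) by exact: ball_open.
have ofB : open (f @` ball 0 s).
  rewrite openE => _ [a Ba <-]; rewrite /interior.
  have [r r0 rB] : exists2 r : R, 0 < r & closed_ball_ Num.norm a r `<=` ball 0 s.
    have /nbhs_closedballP[r] : nbhs a (ball 0 s).
      exact: (open_nbhs_nbhs (conj oB Ba)).
    by rewrite closed_ballE//; exists r%:num.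
  apply/nbhs_ballP; exists (r / (2 * K)); first by rewrite /= divr_gt0// mulr_gt0.
  move=> y; rewrite -{1}ball_normE /= => /ltW fay.
  have [|||x ax <-] := @near_linear_surj f a r y.
  - by move=> x z /rB Bx /rB Bz; exact: jacobian_near_linear.
  - exact: ltW.
  - by rewrite distrC mulrC -ler_pdivlMr ?mulr_gt0.
  by exists x => //; exact: (rB x ax).
have [g gf] : exists g, forall x, ball 0 s x -> g (f x) = x.
  (* Off the image the inverse takes the default value 0. *)
  exists (fun y => xget 0 [set x | ball 0 s x /\ f x = y]) => x Bx.
  case: xgetP => [z _ [Bz fz]|/(_ x)[]//].
  apply/eqP; rewrite -subr_eq0 -normr_le0.
  rewrite (le_trans (near_linear_expand jacobian_near_linear Bz Bx))//.
  by rewrite fz subrr normr0 mulr0.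
exists g; split => //.
- apply/C1_onP => // x Bx; split; [exact: df|exact: Jfc].
- apply/C1_onP => // _ [x Bx <-]; split; last exact: local_inverse_jacobian_cvg.
  by have [] := local_inverse_differentiable gf ofB Bx.
Qed.
End inverse.
End local_inversion.

(** * Uniform limits of families of maps *)

Section uniform_limits.
Context {R : realType}.
Set Implicit Arguments.
Unset Strict Implicit.

Lemma ball0E (V : normedModType R) (s : R) (x : V) : ball 0 s x <-> `|x| < s.
Proof. by rewrite -ball_normE /= sub0r normrN. Qed.

(** The epsilon form of [ulim0] with an explicit radius, so that several convergences can be
    restricted to one ball. *)
Definition ucvg0 N (W : normedModType R) (F : R -> 'rV[R]_N -> W) G (s : R) :=
  forall eps, 0 < eps ->
    \forall e \near 0^'+, forall x, ball 0 s x -> `|G x - F e x| < eps.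

Lemma ulim0P N m n (F : R -> 'rV[R]_N -> 'M[R]_(m, n)) G :
  ulim0 F G <-> exists2 s, 0 < s & ucvg0 F G s.
Proof.
split=> [[A /nbhs_ballP[s /= s0 sA] FG]|[s s0 FG]].
  exists s => // eps eps0.
  have nG : nbhs (G : {uniform` A -> 'M[R]_(m, n)}) [set h | forall y, A y -> `|G y - h y| < eps].
    apply/uniform_nbhs; exists [set xy | ball xy.1 eps xy.2]; split.
      exact: (@entourage_ball _ 'M[R]_(m, n) (PosNum eps0)).
    by move=> h /= H y /H; rewrite -ball_normE.
  have H : \forall e \near 0^'+, forall y, A y -> `|G y - F e y| < eps := FG _ nG.
  by near=> e => x /sA; move: x; near: e.
exists (ball 0 s); first by apply: nbhsx_ballx.
move=> P /uniform_nbhs[E [entE EP]].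
have [eps eps0 epsE] : exists2 eps : R, 0 < eps & forall x y : 'M[R]_(m, n), `|x - y| < eps -> E (x, y).
  move: entE; rewrite -entourage_ballE => -[eps /= eps0 epsE]; exists eps => // x y xy.
  by apply: epsE; rewrite /= -ball_normE.
suff : \forall e \near 0^'+, P (F e) by [].
have H := FG _ eps0.
near=> e; apply: EP => y By; apply: epsE.
by move: y By; near: e.
Unshelve. all: by end_near. Qed.

Lemma ucvg0_le N (W : normedModType R) (F : R -> 'rV[R]_N -> W) G s t :
  t <= s -> ucvg0 F G s -> ucvg0 F G t.
Proof.
move=> ts FG eps /FG; apply: filterS => e H x /(le_ball ts); exact: H.
Qed.

Lemma ucvg0_continuous N (W : normedModType R) (F : R -> 'rV[R]_N -> W) G s :
  ucvg0 F G s ->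
  (\forall e \near 0^'+, forall x, ball 0 s x -> F e z @[z --> x] --> F e x) ->
  forall x, ball 0 s x -> G z @[z --> x] --> G x.
Proof.
move=> FG Fc x Bx; apply/cvg_at_normP => eps eps0.
have eps3 : 0 < eps / 3 by rewrite divr_gt0.
near (0 : R)^'+ => e.
have FGe y : ball 0 s y -> `|G y - F e y| < eps / 3.
  by move: y; near: e; exact: FG.
have Fce : F e z @[z --> x] --> F e x.
  by move: (x) Bx; near: e.
have nB : \forall y \near x, ball 0 s y by apply: open_nbhs_nbhs; split => //; exact: ball_open.
have nF : \forall y \near x, `|F e x - F e y| < eps / 3 by exact: (cvg_at_normP _ _ _).1 Fce _ eps3.
near=> y.
have -> : G x - G y = (G x - F e x) + (F e x - F e y) - (G y - F e y).
  by rewrite subrKA opprB subrKA.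
have By : ball 0 s y by near: y.
have Fy : `|F e x - F e y| < eps / 3 by near: y.
have -> : eps = eps / 3 + eps / 3 + eps / 3 by field.
rewrite (le_lt_trans (ler_normB _ _))// ltrD// ?FGe// (le_lt_trans (ler_normD _ _))//.
by rewrite ltrD// FGe.
Unshelve. all: by end_near. Qed.

Lemma differentiable_mulmxr n m (A : 'M[R]_(n, m)) x :
  differentiable (fun v : 'rV[R]_n => v *m A) x /\ 'J (fun v : 'rV[R]_n => v *m A) x = A.
Proof.
apply/jacobianP => eta eta0; near=> h.
by rewrite mulmxDl addrK subrr normr0 mulr_ge0// ltW.
Unshelve. all: by end_near. Qed.

Lemma jacobian_comp n m p (f : 'rV[R]_m -> 'rV[R]_p) (g : 'rV[R]_n -> 'rV[R]_m) x A B :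
  differentiable g x /\ 'J g x = A -> differentiable f (g x) /\ 'J f (g x) = B ->
  differentiable (f \o g) x /\ 'J (f \o g) x = A *m B.
Proof.
move=> [dg <-] [df <-]; split; first exact: differentiable_comp.
by apply/row_matrixP => i; rewrite !rowE mulmxA -!diff_jacobian diff_comp.
Qed.

Lemma jacobianB n m (f g : 'rV[R]_n -> 'rV[R]_m) x A B :
  differentiable f x /\ 'J f x = A -> differentiable g x /\ 'J g x = B ->
  differentiable (fun z => f z - g z) x /\ 'J (fun z => f z - g z) x = A - B.
Proof.
move=> /jacobianP nf /jacobianP ng; apply/jacobianP => eta eta0.
have eta2 : 0 < eta / 2 by rewrite divr_gt0.
have {}nf := nf _ eta2; have {}ng := ng _ eta2.
near=> h.
have -> : f (h + x) - g (h + x) - (f x - g x) - h *m (A - B) =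
  (f (h + x) - f x - h *m A) - (g (h + x) - g x - h *m B).
  rewrite mulmxBr; move: (h *m A) (h *m B) (f _) (g _) (f _) (g _) => p q a b c d.
  by apply/rowP => i; rewrite !mxE; ring.
rewrite (le_trans (ler_normB _ _))// (splitr eta) mulrDl lerD//; near: h; exact.
Unshelve. all: by end_near. Qed.

Lemma jacobian_conj n (f : 'rV[R]_n -> 'rV[R]_n) (A B : 'M[R]_n) x :
  differentiable f (x *m A) ->
  differentiable (fun v => f (v *m A) *m B) x /\
  'J (fun v => f (v *m A) *m B) x = A *m 'J f (x *m A) *m B.
Proof.
move=> dfx; have fA := jacobian_comp (differentiable_mulmxr A x) (conj dfx erefl).
exact: (jacobian_comp fA (differentiable_mulmxr B _)).
Qed.

(** The explicit [d] depends only on the limits and [eps], so it serves pointwise and uniform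
    convergence alike. *)
Lemma mulmx_dist_lt m n p (u0 : 'M[R]_(m, n)) (v0 : 'M[R]_(n, p)) eps : 0 < eps ->
  exists2 d, 0 < d & forall u v, `|u0 - u| < d -> `|v0 - v| < d ->
    `|u0 *m v0 - u *m v| < eps.
Proof.
move=> eps0; pose C : R := n%:R * (`|v0| + (`|u0| + 1)) + 1.
have C0 : 0 < C by rewrite ltr_wpDl// mulr_ge0// addr_ge0// addr_ge0.
(* The minimum with 1 keeps [|u|] below [|u0| + 1]. *)
exists (Num.min 1 (eps / C)); first by rewrite lt_min ltr01 divr_gt0.
set d := Num.min _ _ => u v ud vd.
have d1 : d <= 1 by rewrite ge_min lexx.
have dC : d * C <= eps by rewrite -ler_pdivlMr// ge_min lexx orbT.
have -> : u0 *m v0 - u *m v = (u0 - u) *m v0 + u *m (v0 - v).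
  by rewrite mulmxBl mulmxBr subrKA.
have u1 : `|u| <= `|u0| + 1.
  rewrite -[u](subKr u0) (le_trans (ler_normB _ _))// lerD2l.
  by rewrite (le_trans (ltW ud)).
have d0 : 0 < d by exact: le_lt_trans ud.
rewrite (lt_le_trans _ dC)// (le_lt_trans (ler_normD _ _))//.
have H1 : `|(u0 - u) *m v0| <= n%:R * `|v0| * d.
  by rewrite (le_trans (norm_mulmx_le _ _))// ler_wpM2l ?mulr_ge0// ltW.
have H2 : `|u *m (v0 - v)| <= n%:R * d * (`|u0| + 1).
  rewrite (le_trans (norm_mulmx_le _ _))// ler_pM ?mulr_ge0//.
  by rewrite ler_wpM2l// ltW.
rewrite (le_lt_trans (lerD H1 H2))// /C.
rewrite (_ : _ + _ = d * (n%:R * (`|v0| + (`|u0| + 1)))); last by ring.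
by rewrite ltr_pM2l// ltrDl.
Qed.

Lemma cvg_at_mulmx m n p (V : normedModType R) (u : V -> 'M[R]_(m, n))
    (v : V -> 'M[R]_(n, p)) (x : V) (u0 : 'M[R]_(m, n)) (v0 : 'M[R]_(n, p)) :
  u z @[z --> x] --> u0 -> v z @[z --> x] --> v0 ->
  u z *m v z @[z --> x] --> u0 *m v0.
Proof.
move=> uu vv; apply/cvg_at_normP => e /(mulmx_dist_lt u0 v0)[d d0 H].
have nu := (cvg_at_normP _ _ _).1 uu d d0.
have nv := (cvg_at_normP _ _ _).1 vv d d0.
by near=> z; apply: H; near: z.
Unshelve. all: by end_near. Qed.

Lemma norm_cvg_le (V : normedModType R) (u : R -> V) (l a : V) b (F : set_system R) :
  ProperFilter F -> u e @[e --> F] --> l -> (\forall e \near F, `|u e - a| <= b) ->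
  `|l - a| <= b.
Proof.
move=> PF ul ua; apply/ler_addgt0Pr => eps eps0.
near F => e; rewrite -(subrKA (u e)) addrC (le_trans (ler_normD _ _))// lerD//.
  by near: e.
by apply/ltW; near: e; move/cvgrPdist_lt : ul; apply.
Unshelve. all: by end_near. Qed.

(** Completeness gives pointwise limits; passing to the limit in the Cauchy bound at fixed [x] makes
    the convergence uniform. *)
Lemma ucauchy_cvg N (W : completeNormedModType R) (F : R -> 'rV[R]_N -> W) s :
  (forall eps, 0 < eps -> exists d, \forall e \near 0^'+,
     forall x, ball 0 s x -> `|F d x - F e x| <= eps) ->
  exists G, ucvg0 F G s.
Proof.
move=> FC.
have Fcvg x : ball 0 s x -> cvg (F e x @[e --> 0^'+]).
  move=> Bx; apply/cauchy_cvgP/cauchy_exP => eps eps0.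
  have eps2 : 0 < eps / 2 by rewrite divr_gt0.
  have [d Fd] := FC _ eps2; exists (F d x).
  suff : \forall e \near 0^'+, ball (F d x) eps (F e x) by [].
  near=> e; rewrite -ball_normE /=; apply: (@le_lt_trans _ _ (eps / 2)).
    by move: (x) Bx; near: e.
  by rewrite ltr_pdivrMr// ltr_pMr// ltr1n.
exists (fun x => lim (F e x @[e --> 0^'+])) => eps eps0.
have eps4 : 0 < eps / 4 by rewrite divr_gt0.
have [d Fd] := FC _ eps4; near=> e => x Bx.
have Fde : `|F d x - F e x| <= eps / 4 by move: (x) Bx; near: e.
have : `|lim (F e x @[e --> 0^'+]) - F d x| <= eps / 4.
  apply: norm_cvg_le (Fcvg _ Bx) _.
  by near=> e'; rewrite distrC; move: (x) Bx; near: e'.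
move=> Fl; rewrite -(subrKA (F d x)) (le_lt_trans (ler_normD _ _))//.
rewrite (le_lt_trans (lerD Fl Fde))//; lra.
Unshelve. all: by end_near. Qed.

(** * Families of maps with uniformly convergent Jacobians *)

Section family.
Variables (N : nat) (F : R -> 'rV[R]_N -> 'rV[R]_N) (lam : 'rV[R]_N -> 'M[R]_N).
Variable s : R.
Hypotheses (s0 : 0 < s) (F0 : forall e, F e 0 = 0).
Hypothesis dF : \forall e \near 0^'+, forall x, ball 0 s x -> differentiable (F e) x.
Hypothesis JF : ucvg0 (fun e => jacobian (F e)) lam s.

(** Mean value inequality for [F d - F e] between [x] and 0, where both maps vanish, compared with
    the zero matrix. *)
Lemma ucvg0_of_jacobian : exists L, ucvg0 F L s.
Proof.
apply: ucauchy_cvg => eps eps0.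
(* The summand 1 keeps the denominator positive when [N] is 0. *)
pose q := eps / (N%:R * s + 1).
have q0 : 0 < q by rewrite divr_gt0// ltr_wpDl// mulr_ge0// ltW.
have q2 : 0 < q / 2 by rewrite divr_gt0.
near (0 : R)^'+ => d; exists d.
have dFd : forall x, ball 0 s x -> differentiable (F d) x by near: d.
have JFd : forall x, ball 0 s x -> `|lam x - 'J (F d) x| < q / 2.
  by near: d; exact: JF.
near=> e => x Bx.
have dFe : forall x, ball 0 s x -> differentiable (F e) x by near: e.
have JFe : forall x, ball 0 s x -> `|lam x - 'J (F e) x| < q / 2.
  by near: e; exact: JF.
have D z : ball 0 s z -> _ := fun Bz =>
  jacobianB (conj (dFd z Bz) erefl) (conj (dFe z Bz) erefl).
have B0 : ball 0 s (0 : 'rV[R]_N) by exact: ballxx.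
have := @mean_value_jacobian _ _ _ (fun z => F d z - F e z) 0 q 0 s _ _ x 0 Bx B0.
rewrite !F0 subrr subr0 mulmx0 !subr0 => H.
apply: (le_trans (H _ _)) => [z /D[]//|z Bz|].
  rewrite subr0 (D z Bz).2 -(subrKA (lam z)) (le_trans (ler_normD _ _))//.
  by rewrite (splitr q) lerD// ltW ?JFe// distrC JFd.
rewrite (@le_trans _ _ (q * (N%:R * s + 1)))//; last first.
  by rewrite /q divfK// gt_eqF// ltr_wpDl// mulr_ge0// ltW.
rewrite (_ : _ * _ = q * (N%:R * `|x|)); last by ring.
rewrite ler_wpM2l ?(ltW q0)// ler_wpDr// ler_wpM2l//.
by apply/ltW/ball0E.
Unshelve. all: by end_near. Qed.

(** On a small ball around [x] all late Jacobians are close to [lam x]; the resulting mean value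
    estimate for [F e] is uniform in [e] and survives the limit. *)
Lemma ucvg0_jacobian L : ucvg0 F L s ->
  (forall x, ball 0 s x -> lam z @[z --> x] --> lam x) ->
  forall x, ball 0 s x -> differentiable L x /\ 'J L x = lam x.
Proof.
move=> FL lamc x Bx; apply/jacobianP => eta eta0.
pose q := eta / (N%:R + 1).
have q0 : 0 < q by rewrite divr_gt0// ltr_wpDl.
have q2 : 0 < q / 2 by rewrite divr_gt0.
have nB : \forall y \near x, ball 0 s y.
  by apply: open_nbhs_nbhs; split => //; exact: ball_open.
have nlam := (cvg_at_normP _ _ _).1 (lamc x Bx) _ q2.
have [d d0 dE] : exists2 d, 0 < d & forall y, ball x d y ->
    ball 0 s y /\ `|lam x - lam y| < q / 2.
  have : \forall y \near x, ball 0 s y /\ `|lam x - lam y| < q / 2.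
    by near=> y; split; near: y.
  by move=> /nbhs_ballP[d d0 dE]; exists d => // y /dE.
have nd : \forall h \near (0 : 'rV[R]_N), `|h| < d by exact: (@nbhs0_lt _ 'rV[R]_N).
near=> h.
have hd : ball x d (h + x).
  by rewrite -ball_normE /= opprD addrCA subrr addr0 normrN; near: h.
have [Bhx _] := dE _ hd.
have cL y : ball 0 s y -> F e y @[e --> 0^'+] --> L y.
  move=> By; apply/cvgrPdist_lt => eps /FL; apply: filterS => e; exact.
have C : F e (h + x) - F e x @[e --> 0^'+] --> L (h + x) - L x.
  by apply: cvgB; exact: cL.
apply: norm_cvg_le C _.
near=> e.
have dFe : forall x, ball 0 s x -> differentiable (F e) x by near: e.
have JFe : forall x, ball 0 s x -> `|lam x - 'J (F e) x| < q / 2.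
  by near: e; exact: JF.
rewrite -{2}(addrK x h) (le_trans (@mean_value_jacobian _ _ _ (F e) _ q x d _ _ _ _ _ _))//.
- by move=> z /dE[Bz _]; exact: dFe.
- move=> z /dE[Bz lxz]; rewrite distrC -(subrKA (lam z)) (splitr q).
  by rewrite (le_trans (ler_normD _ _))// lerD// ltW// JFe.
- exact: ballxx.
rewrite addrK ler_wpM2r// /q mulrC -mulrA ler_piMr ?ltW//.
by rewrite mulrC ltr_pdivrMr ?mul1r ?ltrDl// ltr_wpDl.
Unshelve. all: by end_near. Qed.
End family.

End uniform_limits.

(** * Dilations *)

Section dilations.
Context {R : realType}.
Set Implicit Arguments.
Unset Strict Implicit.

Lemma cvg_at_congr (V W : normedModType R) (f g : V -> W) (x : V) (l : W) :
  (\forall z \near x, f z = g z) -> f z @[z --> x] --> l -> g z @[z --> x] --> l.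
Proof.
move=> fg /cvg_at_normP fl; apply/cvg_at_normP => e e0.
have nf := fl e e0; near=> z.
by rewrite (_ : g z = f z); [near: z|apply/esym; near: z].
Unshelve. all: by end_near. Qed.

Lemma cvg_at_mulmxr m n p (V : normedModType R) (u : V -> 'M[R]_(m, n))
    (A : 'M[R]_(n, p)) (x : V) (u0 : 'M[R]_(m, n)) :
  u z @[z --> x] --> u0 -> u z *m A @[z --> x] --> u0 *m A.
Proof. by move=> uu; apply: cvg_at_mulmx => //; exact: cvg_cst. Qed.

Lemma cvg_at_mulmxl m n p (V : normedModType R) (u : V -> 'M[R]_(n, p))
    (A : 'M[R]_(m, n)) (x : V) (u0 : 'M[R]_(n, p)) :
  u z @[z --> x] --> u0 -> A *m u z @[z --> x] --> A *m u0.
Proof. by move=> uu; apply: cvg_at_mulmx => //; exact: cvg_cst. Qed.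

Lemma cvg_mulmxr_id n m (A : 'M[R]_(n, m)) (x : 'rV[R]_n) :
  z *m A @[z --> x] --> x *m A.
Proof. by apply: cvg_at_mulmxr; exact: cvg_id. Qed.

Section dilation.
Variables (N : nat) (sigma : 'I_N -> R).
Implicit Types (e r s : R) (x : 'rV[R]_N).

(** As right multiplications by diagonal matrices, dilations fall under the Jacobian rules above. *)
Lemma dilE e x : dil sigma e x = x *m diag_mx (\row_k e `^ sigma k).
Proof. by apply/rowP => k; rewrite mul_mx_diag !mxE mulrC. Qed.

Lemma dil_invE e x : dil_inv sigma e x = x *m diag_mx (\row_k (e `^ sigma k)^-1).
Proof. by apply/rowP => k; rewrite mul_mx_diag !mxE mulrC. Qed.

Lemma rescale_fieldE r (X : 'rV[R]_N -> 'rV[R]_N) e x :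
  rescale_field sigma r X e x =
  X (dil sigma e x) *m diag_mx (\row_k e `^ (r - sigma k)).
Proof. by apply/rowP => k; rewrite mul_mx_diag !mxE mulrC. Qed.

Lemma dil_invK e : 0 < e -> cancel (dil_inv sigma e) (dil sigma e).
Proof.
by move=> e0 x; apply/rowP => k; rewrite !mxE mulrA divff ?mul1r// gt_eqF// powR_gt0.
Qed.

Lemma ball_dil e s x : (forall k, 0 < sigma k) -> 0 < e <= 1 ->
  ball 0 s x -> ball 0 s (dil sigma e x).
Proof.
move=> sigma0 /andP[e0 e1] /ball0E xs; apply/ball0E; apply: le_lt_trans xs.
apply: mx_norm_le => // i k; rewrite ord1 mxE normrM ger0_norm ?powR_ge0//.
rewrite (le_trans _ (mx_coord_le_norm x 0 k))// ler_piMl//.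
by rewrite -(powRr0 e) ger_powR ?e0// ltW.
Qed.

Lemma conj_dil0 (f : 'rV[R]_N -> 'rV[R]_N) e : f 0 = 0 -> conj_dil sigma f e 0 = 0.
Proof. by move=> f0; rewrite /conj_dil /= dilE mul0mx f0 dil_invE mul0mx. Qed.

Lemma conj_dil_jacobian (f : 'rV[R]_N -> 'rV[R]_N) e x :
  differentiable f (dil sigma e x) ->
  differentiable (conj_dil sigma f e) x /\
  'J (conj_dil sigma f e) x = diag_mx (\row_k e `^ sigma k) *m
    'J f (dil sigma e x) *m diag_mx (\row_k (e `^ sigma k)^-1).
Proof.
have -> : conj_dil sigma f e = fun v => f (v *m diag_mx (\row_k e `^ sigma k)) *m
    diag_mx (\row_k (e `^ sigma k)^-1).
  by apply/funext => v; rewrite /conj_dil /= dil_invE dilE.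
by rewrite dilE => /jacobian_conj; exact.
Qed.

Lemma conj_dil_jacobian_cvg (U : set 'rV[R]_N) f e x :
  C1_on U f -> open U -> U (dil sigma e x) ->
  'J (conj_dil sigma f e) z @[z --> x] --> 'J (conj_dil sigma f e) x.
Proof.
move=> + oU Ux => /(C1_onP _ oU) fU.
set A := diag_mx (\row_k e `^ sigma k).
have cA : dil sigma e z @[z --> x] --> dil sigma e x.
  rewrite dilE; apply: cvg_at_congr (@cvg_mulmxr_id _ _ A x).
  by near=> z; rewrite dilE.
have nU : \forall z \near x, U (dil sigma e z).
  have : \forall y \near dil sigma e x, U y by exact: open_nbhs_nbhs.
  exact: cA.
rewrite (conj_dil_jacobian (fU _ Ux).1).2.
apply: cvg_at_congr (cvg_at_mulmxr (cvg_at_mulmxl (cvg_comp _ _ cA (fU _ Ux).2))).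
near=> z; rewrite (conj_dil_jacobian (fU _ _).1).2//.
by near: z.
Unshelve. all: by end_near. Qed.

Lemma rescale_field_cvg (U : set 'rV[R]_N) X r e x :
  open U -> {within U, continuous X} -> U (dil sigma e x) ->
  rescale_field sigma r X e z @[z --> x] --> rescale_field sigma r X e x.
Proof.
move=> oU; rewrite continuous_open_subspace// => Xc Ux.
have cA : dil sigma e z @[z --> x] --> dil sigma e x.
  rewrite dilE; apply: cvg_at_congr (@cvg_mulmxr_id _ _ _ x).
  by near=> z; rewrite dilE.
have XU := Xc _ (mem_set Ux).
rewrite rescale_fieldE.
apply: cvg_at_congr (cvg_at_mulmxr (cvg_comp _ _ cA XU)).
by near=> z; rewrite rescale_fieldE.
Unshelve. all: by end_near. Qed.

(** Functoriality of the push-forward, written at the image point so that the inverse of the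
    conjugated map never appears. *)
Lemma rescale_pushforward (U : set 'rV[R]_N) f finv X r e x :
  0 < e -> (forall z, U z -> differentiable f z) ->
  (forall z, U z -> finv (f z) = z) -> U (dil sigma e x) ->
  rescale_field sigma r (pushforward f finv X) e (conj_dil sigma f e x) =
  rescale_field sigma r X e x *m 'J (conj_dil sigma f e) x.
Proof.
move=> e0 df fK Ux; rewrite (conj_dil_jacobian (df _ Ux)).2 !rescale_fieldE.
rewrite /pushforward /conj_dil /= dil_invK// fK// diff_jacobian.
rewrite mulmxA; set J := 'J f _; set v := X _.
(* The weights [e ^ (r - sigma k)] and [e ^ sigma k] combine to the scalar [e ^ r]. *)
have -> : v *m diag_mx (\row_k e `^ (r - sigma k)) *m
    (diag_mx (\row_k e `^ sigma k) *m J) = e `^ r *: (v *m J).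
  rewrite mulmxA scalemxAl; congr (_ *m _); apply/rowP => k.
  rewrite !mul_mx_diag !mxE -mulrA -powRD; last by rewrite (gt_eqF e0) implybT.
  by rewrite subrK mulrC.
apply/rowP => k; rewrite !mul_mx_diag !mxE.
rewrite powRB ?(gt_eqF e0) ?implybT//.
ring.
Qed.
End dilation.

(* Only locally uniform, because Xhat need not be bounded on the ball. *)
Lemma ucvg0_mulmx_local N (u : R -> 'rV[R]_N -> 'rV[R]_N) (v : R -> 'rV[R]_N -> 'M[R]_N)
    (uh : 'rV[R]_N -> 'rV[R]_N) (vh : 'rV[R]_N -> 'M[R]_N) s :
  ucvg0 u uh s -> ucvg0 v vh s ->
  (forall x, ball 0 s x -> uh z @[z --> x] --> uh x) ->
  (forall x, ball 0 s x -> vh z @[z --> x] --> vh x) ->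
  forall x eps, ball 0 s x -> 0 < eps -> exists2 d, 0 < d &
    \forall e \near 0^'+, forall z, ball x d z ->
      `|uh x *m vh x - u e z *m v e z| < eps.
Proof.
move=> Hu Hv cu cv x eps Bx eps0.
have [q q0 H] := mulmx_dist_lt (uh x) (vh x) eps0.
have q2 : 0 < q / 2 by rewrite divr_gt0.
have nB : \forall y \near x, ball 0 s y.
  by apply: open_nbhs_nbhs; split => //; exact: ball_open.
have nu := (cvg_at_normP _ _ _).1 (cu x Bx) _ q2.
have nv := (cvg_at_normP _ _ _).1 (cv x Bx) _ q2.
have : \forall z \near x, [/\ ball 0 s z, `|uh x - uh z| < q / 2 & `|vh x - vh z| < q / 2].
  by near=> z; split; near: z.
move=> /nbhs_ballP[d d0 dE]; exists d => //.
have Hu' := Hu _ q2; have Hv' := Hv _ q2.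
near=> e.
have He : forall x, ball 0 s x -> `|uh x - u e x| < q / 2 by near: e.
have He' : forall x, ball 0 s x -> `|vh x - v e x| < q / 2 by near: e.
move=> z /dE[Bz uz vz]; apply: H.
  rewrite -(subrKA (uh z)) (le_lt_trans (ler_normD _ _))// (splitr q).
  by rewrite ltrD// He.
rewrite -(subrKA (vh z)) (le_lt_trans (ler_normD _ _))// (splitr q).
by rewrite ltrD// He'.
Unshelve. all: by end_near. Qed.

(** * Passing to the limit through the inverse maps *)

Lemma near_linear_ball_surj N (M : 'M[R]_N) (K : R) (f : 'rV[R]_N -> 'rV[R]_N)
    (s : R) (y : 'rV[R]_N) :
  M \in unitmx -> 0 < K -> (forall m (v : 'M[R]_(m, N)), `|v *m invmx M| <= K * `|v|) ->
  near_linear f M (2 * K)^-1 (ball 0 s) -> f 0 = 0 -> 0 < s ->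
  `|y| <= s / 2 / (2 * K) -> exists2 x, ball 0 s x & f x = y.
Proof.
move=> Mu K0 MK fM f0 s0 yt.
have sub : closed_ball_ Num.norm (0 : 'rV[R]_N) (s / 2) `<=` ball 0 s.
  move=> x; rewrite /closed_ball_ /= sub0r normrN => xs; apply/ball0E.
  by rewrite (le_lt_trans xs)// ltr_pdivrMr// ltr_pMr// ltr1n.
have [|||x xs fx] := @near_linear_surj R N M K Mu K0 MK f 0 (s / 2) y.
- by move=> x z /sub Bx /sub Bz; exact: fM.
- by rewrite divr_ge0// ltW.
- by rewrite f0 subr0 mulrC -ler_pdivlMr// mulr_gt0.
by exists x => //; exact: (sub x).
Qed.

(** Near [y0 = L x0], the preimages of [y] under [L] and under [F e] are both close to [x0], so [Gh]
    at one and [G e] at the other are both close to [Gh x0]. Compactness makes this uniform in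
    [y]. *)
Lemma ucvg0_inverse_comp N (M : 'M[R]_N) (K : R) (F G Y : R -> 'rV[R]_N -> 'rV[R]_N)
    (L Linv Gh : 'rV[R]_N -> 'rV[R]_N) (s : R) :
  M \in unitmx -> 0 < K -> (forall m (v : 'M[R]_(m, N)), `|v *m invmx M| <= K * `|v|) ->
  0 < s -> (forall e, F e 0 = 0) -> L 0 = 0 ->
  (\forall e \near 0^'+, near_linear (F e) M (2 * K)^-1 (ball 0 s)) ->
  near_linear L M (2 * K)^-1 (ball 0 s) ->
  ucvg0 F L s ->
  (forall x, ball 0 s x -> Linv (L x) = x) ->
  (forall x, ball 0 s x -> Gh z @[z --> x] --> Gh x) ->
  (forall x eps, ball 0 s x -> 0 < eps -> exists2 d, 0 < d &
    \forall e \near 0^'+, forall z, ball x d z -> `|Gh x - G e z| < eps) ->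
  (\forall e \near 0^'+, forall x, ball 0 s x -> Y e (F e x) = G e x) ->
  ucvg0 Y (Gh \o Linv) (s / 2 / (2 * K)).
Proof.
move=> Mu K0 MK s0 F0 L0 FM LM FL LK cG GG YG eps eps0.
have K2 : 0 < 2 * K by rewrite mulr_gt0.
set t := s / 2 / (2 * K).
pose C : set 'rV[R]_N := closed_ball_ Num.norm 0 t.
have cC : compact C.
  apply: bounded_closed_compact; last exact: closed_closed_ball_.
  exists t; split; first exact: num_real.
  by move=> b tb x; rewrite /C /closed_ball_ /= sub0r normrN => /le_trans; apply; exact: ltW.
have Ct x : C x -> `|x| <= t by rewrite /C /closed_ball_ /= sub0r normrN.
have surj f y : near_linear f M (2 * K)^-1 (ball 0 s) -> f 0 = 0 -> C y ->
    exists2 x, ball 0 s x & f x = y.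
  by move=> fM f0 /Ct; exact: (near_linear_ball_surj Mu K0 MK fM f0 s0).
suff H : \forall e \near 0^'+, C `<=` [set y | `|Gh (Linv y) - Y e y| < eps].
  have sub y : ball 0 t y -> C y.
    by move=> /ball0E yt; rewrite /C /closed_ball_ /= sub0r normrN ltW.
  by near=> e => y /sub; move: y; near: e.
have eps2 : 0 < eps / 2 by rewrite divr_gt0.
(* Near-covering compactness: it suffices to treat [y] near one [y0] and small [e] jointly. *)
move/compact_near_coveringP/near_covering_withinP : cC; apply => y0 Cy0.
have [x0 B0 Lx0] := surj L y0 LM L0 Cy0.
have nGh := (cvg_at_normP _ _ _).1 (cG _ B0) _ eps2.
have [d1 d10 GhE] : exists2 d, 0 < d & forall x, ball x0 d x -> `|Gh x0 - Gh x| < eps / 2.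
  by move: nGh => /nbhs_ballP[d d0 dE]; exists d => // x /dE.
have [d2 d20 GE] := GG x0 _ B0 eps2.
pose d := Num.min d1 d2.
have d0 : 0 < d by rewrite lt_min d10.
have dd1 : d <= d1 by rewrite ge_min lexx.
have dd2 : d <= d2 by rewrite ge_min lexx orbT.
(* Expansion by [2 * K] turns [q] into [d / 2]: one share for [|y0 - y|], one for
   [|L z - F e z|]. *)
pose q := d / 2 / (2 * K).
have q0 : 0 < q by rewrite !divr_gt0.
have ny : \forall y \near y0, `|y0 - y| < q.
  by apply/nbhs_ballP; exists q => // y; rewrite -ball_normE.
have FLq := FL _ q0.
have ne : \forall e \near 0^'+, [/\ near_linear (F e) M (2 * K)^-1 (ball 0 s),
    forall x, ball 0 s x -> `|L x - F e x| < q,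
    forall z, ball x0 d2 z -> `|Gh x0 - G e z| < eps / 2 &
    forall x, ball 0 s x -> Y e (F e x) = G e x].
  by near=> e; split; near: e.
exists ([set y | `|y0 - y| < q], [set e | [/\ near_linear (F e) M (2 * K)^-1 (ball 0 s),
    forall x, ball 0 s x -> `|L x - F e x| < q,
    forall z, ball x0 d2 z -> `|Gh x0 - G e z| < eps / 2 &
    forall x, ball 0 s x -> Y e (F e x) = G e x]]); first by split.
move=> [y e] /= [y0y [FMe FLe GEe YGe]] Cy.
have [x Bx Lx] := surj L y LM L0 Cy.
have [z Bz Fz] := surj _ y FMe (F0 e) Cy.
have qE : 2 * K * q = d / 2 by rewrite mulrC divfK// gt_eqF.
have x0x : ball x0 d1 x.
  rewrite -ball_normE /= (lt_le_trans _ dd1)//.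
  rewrite (le_lt_trans (near_linear_expand Mu K0 MK LM B0 Bx))// Lx0 Lx.
  rewrite (@lt_le_trans _ _ (2 * K * q))// ?ltr_pM2l// qE.
  by rewrite ler_pdivrMr// ler_pMr// ler1n.
(* The expansion bound of [L] is applied to [z] as well, since [L z] is within [q] of
   [F e z = y]. *)
have x0z : ball x0 d2 z.
  rewrite -ball_normE /= (lt_le_trans _ dd2)//.
  rewrite (le_lt_trans (near_linear_expand Mu K0 MK LM B0 Bz))// Lx0.
  have -> : d = 2 * K * (q + q) by rewrite mulrDr qE -splitr.
  rewrite ltr_pM2l// -(subrKA y) (le_lt_trans (ler_normD _ _))// ltrD//.
  by rewrite -Fz distrC FLe.
rewrite -{1}Lx LK// -Fz YGe// -(subrKA (Gh x0)) (le_lt_trans (ler_normD _ _))//.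
by rewrite (splitr eps) ltrD// ?GEe// distrC GhE.
Unshelve. all: by end_near. Qed.

End dilations.

(** * The limit of the rescaled push-forward *)

Theorem theorem6 (R : realType) (N : nat) (sigma : 'I_N -> R)
    (U : set 'rV[R]_N) (X Xhat : 'rV[R]_N -> 'rV[R]_N) (r : R)
    (Phi Phiinv : 'rV[R]_N -> 'rV[R]_N) (lambda : 'rV[R]_N -> 'M[R]_N) :
  (forall k, 0 < sigma k) ->
  open U -> U 0 ->
  {within U, continuous X} ->
  0 < r ->
  ulim0 (rescale_field sigma r X) Xhat ->
  C1_diffeo U Phi Phiinv ->
  Phi 0 = 0 ->
  ulim0 (fun e => Dmx (conj_dil sigma Phi e)) lambda ->
  \det (lambda 0) != 0 ->
  exists (L Linv Yhat : 'rV[R]_N -> 'rV[R]_N) (A : set 'rV[R]_N),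
    [/\ A 0,
        C1_diffeo A L Linv,
        ulim0 (conj_dil sigma Phi) L,
        ulim0 (rescale_field sigma r (pushforward Phi Phiinv X)) Yhat &
        \forall y \near (0 : 'rV[R]_N), Yhat y = pushforward L Linv Xhat y].
Proof.
move=> sigma0 oU U0 Xc r0 /ulim0P[sX sX0 HX] [_ _ PhiK Phi_C1 _] Phi0.
move=> /ulim0P[sl sl0 Hl] det0.
pose F := conj_dil sigma Phi.
(* ['J] acts on row vectors from the right, whence the transpose. *)
pose lam x := (lambda x)^T.
pose M := lam 0.
have Mu : M \in unitmx by rewrite unitmx_tr unitmxE unitfE.
pose K := N%:R * `|invmx M| + 1.
have K0 : 0 < K by rewrite ltr_wpDl// mulr_ge0.
have MK m (v : 'M[R]_(m, N)) : `|v *m invmx M| <= K * `|v|.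
  by rewrite (le_trans (norm_mulmx_le _ _))// ler_wpM2r// lerDl.
have K2 : 0 < 2 * K by rewrite mulr_gt0.
have [sU /= sU0 UE] : exists2 s : R, 0 < s & ball 0 s `<=` U.
  have /nbhs_ballP[s s0 sE] : nbhs (0 : 'rV[R]_N) U by exact: open_nbhs_nbhs.
  by exists s.
(* On this ball both given limits are uniform, and dilations with [e <= 1] stay inside [U]. *)
pose s := Num.min sX (Num.min sl sU).
have s0 : 0 < s by rewrite !lt_min sX0 sl0.
have FU e x : 0 < e <= 1 -> ball 0 s x -> U (dil sigma e x).
  move=> e01 Bx; apply/UE/(ball_dil sigma0 e01).
  by apply: le_ball Bx; rewrite !ge_min lexx !orbT.
have e01 : \forall e \near (0 : R)^'+, 0 < e <= 1.
  near=> e; apply/andP; split; near: e; first exact: nbhs_right_gt.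
  exact: nbhs_right_le.
have F0 e : F e 0 = 0 by exact: conj_dil0.
have Phi_d z : U z -> differentiable Phi z by move=> Uz; exact: (Phi_C1.1 z Uz).
have dF : \forall e \near 0^'+, forall x, ball 0 s x -> differentiable (F e) x.
  near=> e => x Bx; apply: (conj_dil_jacobian _).1; apply/Phi_d/FU => //.
  by near: e.
have JF : ucvg0 (fun e => jacobian (F e)) lam s.
  have sl' : s <= sl by rewrite !ge_min lexx orbT.
  move=> eps /(ucvg0_le sl' Hl) H; near=> e => x Bx.
  rewrite -norm_trmx linearB /= trmxK.
  by move: (x) Bx; near: e.
have lamc : forall x, ball 0 s x -> lam z @[z --> x] --> lam x.
  apply: ucvg0_continuous JF _; near=> e => x Bx.
  apply: (conj_dil_jacobian_cvg Phi_C1 oU); apply: FU => //.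
  by near: e.
have Xhc : forall x, ball 0 s x -> Xhat z @[z --> x] --> Xhat x.
  have HXs : ucvg0 (rescale_field sigma r X) Xhat s.
    by apply: ucvg0_le HX; rewrite ge_min lexx.
  apply: ucvg0_continuous HXs _; near=> e => x Bx.
  apply: (rescale_field_cvg oU Xc); apply: FU => //.
  by near: e.
have [L FL] := ucvg0_of_jacobian s0 F0 dF JF.
have JL := ucvg0_jacobian dF JF FL lamc.
(* Chosen so that [N%:R * c] is at most [(2 * K)^-1]; the summand 1 covers [N = 0]. *)
pose c : R := (2 * K)^-1 / (N%:R + 1).
have c0 : 0 < c by rewrite divr_gt0 ?invr_gt0// ltr_wpDl.
have cK : N%:R * c <= (2 * K)^-1.
  rewrite /c mulrCA ler_piMr ?invr_ge0 ?(ltW K2)//.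
  by rewrite ler_pdivrMr ?ltr_wpDl// mul1r lerDl.
have c2 : 0 < c / 2 by rewrite divr_gt0.
(* One half of [c] bounds the variation of [lam] around 0, the other the distance from the Jacobians
   of [F e] to [lam]. *)
have [s' s'0 [s's lamM]] : exists2 s' : R, 0 < s' & s' <= s /\
    forall x, ball 0 s' x -> `|lam x - M| < c / 2.
  have B0 : ball 0 s (0 : 'rV[R]_N) by exact: ballxx.
  have /nbhs_ballP[d d0 dE] := (cvg_at_normP _ _ _).1 (lamc _ B0) _ c2.
  exists (Num.min s d); first by rewrite lt_min s0.
  split; first by rewrite ge_min lexx.
  move=> x Bx; rewrite distrC; apply: dE.
  by apply: le_ball Bx; rewrite ge_min lexx orbT.
have sub (x : 'rV[R]_N) : ball 0 s' x -> ball 0 s x by exact: le_ball.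
have dL x : ball 0 s' x -> differentiable L x by move=> /sub/JL[].
have JLM x : ball 0 s' x -> `|'J L x - M| <= c.
  move=> Bx; rewrite (JL _ (sub _ Bx)).2 (le_trans (ltW (lamM _ Bx)))//.
  by rewrite ler_pdivrMr// ler_pMr// ler1n.
have JLc x : ball 0 s x -> 'J L z @[z --> x] --> 'J L x.
  move=> Bx; rewrite (JL _ Bx).2; apply: cvg_at_congr (lamc _ Bx).
  have nB : \forall y \near x, ball 0 s y.
    by apply: open_nbhs_nbhs; split => //; exact: ball_open.
  by near=> z; rewrite (JL _ _).2//; near: z.
have JLc' x : ball 0 s' x -> 'J L z @[z --> x] --> 'J L x by move=> /sub/JLc.
have [Linv LLinv] := C1_diffeo_ball Mu K0 MK cK dL JLM JLc'.
(* [Yhat] is taken to be the push-forward everywhere, which makes the final equality immediate. *)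
exists L, Linv, (pushforward L Linv Xhat), (ball 0 s').
split => //.
- exact: ballxx.
- by apply/ulim0P; exists s.
- apply/ulim0P; exists (s' / 2 / (2 * K)); first by rewrite !divr_gt0.
  (* Separates the product [Xhat x *m 'J L x], a limit in the source variable, from the inverse
     map. *)
  have -> : pushforward L Linv Xhat = (fun x => Xhat x *m 'J L x) \o Linv.
    by apply/funext => y; rewrite /pushforward diff_jacobian.
  have L0 : L 0 = 0.
    apply/normr0_eq0/le_anti; rewrite normr_ge0 andbT; apply/ler_addgt0Pr => eps eps0.
    near (0 : R)^'+ => e; rewrite add0r ltW//.
    have H : forall x, ball 0 s x -> `|L x - F e x| < eps by near: e; exact: FL.
    by have := H 0 (ballxx 0 s0); rewrite F0 subr0.
  have HX' : ucvg0 (rescale_field sigma r X) Xhat s'.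
    by apply: ucvg0_le HX; rewrite (le_trans s's)// ge_min lexx.
  have JF' : ucvg0 (fun e => jacobian (F e)) (jacobian L) s'.
    move=> eps /(ucvg0_le s's JF) H; near=> e => x Bx.
    rewrite (JL _ (sub _ Bx)).2.
    by move: (x) Bx; near: e.
  apply: (@ucvg0_inverse_comp _ _ M K F
    (fun e x => rescale_field sigma r X e x *m 'J (F e) x) _ L) => //.
  + have H := JF _ c2.
    near=> e.
    have dFe : forall x, ball 0 s x -> differentiable (F e) x by near: e.
    have JFe : forall x, ball 0 s x -> `|lam x - 'J (F e) x| < c / 2 by near: e.
    apply: (jacobian_near_linear cK) => x Bx; first exact/dFe/sub.
    rewrite -(subrKA (lam x)) (le_trans (ler_normD _ _))// (splitr c) lerD//.
      by rewrite ltW// distrC JFe//; exact: sub.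
    by rewrite ltW// lamM.
  + exact: (jacobian_near_linear cK dL JLM).
  + exact: ucvg0_le FL.
  + by case: LLinv.
  + by move=> x Bx; apply: cvg_at_mulmx; [exact/Xhc/sub|exact: JLc'].
  + by apply: ucvg0_mulmx_local => // x Bx; exact/Xhc/sub.
  + near=> e => x Bx.
    have e01' : 0 < e <= 1 by near: e.
    have e0 : 0 < e by case/andP: e01'.
    apply: (rescale_pushforward _ _ e0 Phi_d PhiK).
    by apply: FU => //; exact: sub.
- by near=> y.
Unshelve. all: by end_near. Qed.
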